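(* Fix a positive constant $d$. On the hypercube $Q_n$, a robber can escape capture against $n^d$ cops for at least $(1-o(1))\frac{1}{2} n \ln n$ rounds. That is, there is a function $\varepsilon(n) \to 0$ such that for all sufficiently large $n$, for every strategy of $n^d$ cops on $Q_n$, the robber has a strategy that avoids capture for at least $(1-\varepsilon(n))\frac{1}{2} n\ln n$ rounds.
   Context: Cops and Robbers is played on a finite reflexive graph (every vertex carries a loop, so a player may pass). The cops first choose starting vertices, then the robber chooses a starting vertex; afterwards players alternate, the cops moving first: each cop moves to a neighbouring vertex or stays, then the robber moves to a neighbouring vertex or stays. A round is a cop move together with the subsequent robber move. The cops capture the robber when some cop occupies the same vertex as the robber. $Q_n$ is the $n$-dimensional hypercube: vertices are binary strings of length $n$, adjacent iff they differ in exactly one coordinate. *)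

(* Defs.v *)
From mathcomp Require Import all_boot.

Set Implicit Arguments.
Unset Strict Implicit.
Unset Printing Implicit Defensive.

(* Binary strings of length n, adjacent iff they differ in exactly one
   coordinate. *)
Definition hypercube (n : nat) : rel (n.-tuple bool) :=
  fun x y => #|[set i : 'I_n | tnth x i != tnth y i]| == 1%N.

Section CopsAndRobber.

Variables (T : finType) (adj : rel T) (k : nat).

(* The loops of the reflexive graph: a player may stay. *)
Definition step : rel T := fun x y => (x == y) || adj x y.

Definition cops := {ffun 'I_k -> T}.

Definition position := (cops * T)%type.

Definition captured (p : position) : bool := [exists i, p.1 i == p.2].

(* Strategies may depend on the whole history of the game: h lists the positions
   at the ends of the earlier rounds, most recent first (its last entry is the
   initial position), and p is the current position. *)
Record cop_strategy := CopStrategy {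
  cop_start : cops;
  cop_move : seq position -> position -> cops;
  cop_legal : forall (h : seq position) (p : position) (i : 'I_k),
    step (p.1 i) (cop_move h p i)
}.

(* The robber sees the cops' initial placement before choosing a vertex, and in
   each round sees the new placement c of the cops before moving. *)
Record robber_strategy := RobberStrategy {
  rob_start : cops -> T;
  rob_move : seq position -> position -> cops -> T;
  rob_legal : forall (h : seq position) (p : position) (c : cops),
    step p.2 (rob_move h p c)
}.

(* The earlier positions and the current position after t rounds; the recursion
   does not stop at a capture. *)
Fixpoint play (s : cop_strategy) (r : robber_strategy) (t : nat) :
    seq position * position :=
  if t is t'.+1 then
    let: (h, p) := play s r t' in
    let c := cop_move s h p in
    (p :: h, (c, rob_move r h p c))
  else ([::], (cop_start s, rob_start r (cop_start s))).

Definition position_after s r t : position := (play s r t).2.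

(* In round t.+1, after the cops have moved and before the robber moves. *)
Definition midround_position s r t : position :=
  ((position_after s r t.+1).1, (position_after s r t).2).

Definition evades s r (N : nat) : Prop :=
  (forall t, t <= N -> ~~ captured (position_after s r t)) /\
  (forall t, t < N -> ~~ captured (midround_position s r t)).

End CopsAndRobber.

(* Main.v *)
(** The robber plays greedily for the potential [sum_i a_t ^ dist (cop_i, robber)],
with weights [a_t < 1] decreasing in [t]. Before each cop move he keeps it
below [a_t]; a cop move divides each term by [a_t] at worst, so it stays below 1,
whereas a capture would make one term equal to 1. Flipping a uniformly random
coordinate turns a cop at distance [m] into the average weight
[(m / n) a^(m-1) + (1 - m / n) a^(m+1)], so by Bernoulli's inequality some flip
restores the bound as soon as [a_(t+1) + (1 / a_(t+1) - a_(t+1)) / n <= a_t].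
Since [1 / a - a] is about [2 (1 - a)], the choice
[a_t = 1 - delta (1 - (2 + 2 delta) / n)^(N - t)] works. Averaging over all vertices, a good
start exists if [k (1 - (1 - a_0) / 2)^n < a_0], and for
[N = (1 - eps) n ln n / 2] and [delta = eps / 4] the quantity [n (1 - a_0)] is at
least about [eps n^(eps / 2)], which beats [d ln n] when
[eps = 1 / sqrt (ln n)]. *)

Require Import Defs.
From mathcomp Require Import all_boot all_order all_algebra.
From mathcomp Require Import all_classical all_reals all_analysis.
From mathcomp Require Import ring lra.
Import Order.TTheory GRing.Theory Num.Theory.
Import numFieldNormedType.Exports.

Local Open Scope ring_scope.

(** * Hamming distance and coordinate flips *)

Definition hamming (n : nat) (x y : n.-tuple bool) : nat :=
  #|[set i : 'I_n | tnth x i != tnth y i]%SET|.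

Definition flip (n : nat) (x : n.-tuple bool) (i : 'I_n) : n.-tuple bool :=
  [tuple tnth x j (+) (j == i) | j < n].

Lemma hammingxx (n : nat) (x : n.-tuple bool) : hamming n x x = 0%N.
Proof. by apply: eq_card0 => i; rewrite inE eqxx. Qed.

Lemma hamming_triangle (n : nat) (x y z : n.-tuple bool) :
  (hamming n x z <= hamming n x y + hamming n y z)%N.
Proof.
rewrite /hamming; apply: leq_trans (leq_card_setU _ _).
apply: subset_leq_card; apply/fintype.subsetP => i; rewrite !inE.
by case: (tnth x i) (tnth y i) (tnth z i) => [] [] [].
Qed.

Lemma hamming_step (n : nat) (x y : n.-tuple bool) :
  step (@hypercube n) x y -> (hamming n x y <= 1)%N.
Proof.
by case/orP => [/eqP <-|/eqP <-//]; rewrite hammingxx.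
Qed.

Lemma hamming_flip (n : nat) (c x : n.-tuple bool) (i : 'I_n) :
  hamming n c (flip n x i) =
    if tnth c i != tnth x i then (hamming n c x).-1 else (hamming n c x).+1.
Proof.
rewrite /hamming; set S := [set j | tnth c j != tnth x j]%SET.
have -> : [set j | tnth c j != tnth (flip n x i) j]%SET =
          if tnth c i != tnth x i then (S :\ i)%SET else (i |: S)%SET.
  apply/setP => j; case: ifP => ci; rewrite !inE tnth_mktuple.
    have [->|_] := eqVneq j i; last by rewrite addbF.
    by case: (tnth c i) (tnth x i) ci => [] [].
  have [->|_] := eqVneq j i; last by rewrite addbF.
  by case: (tnth c i) (tnth x i) ci => [] [].
case: ifP => ci; last by rewrite cardsU1 inE ci.
by rewrite (cardsD1 i S) inE ci.
Qed.

Lemma step_flip (n : nat) (x : n.-tuple bool) (i : 'I_n) :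
  step (@hypercube n) x (flip n x i).
Proof.
by apply/orP; right; rewrite /hypercube -/(hamming n _ _) hamming_flip eqxx hammingxx.
Qed.

(** * Averages of the weights over flips and over all vertices *)

Lemma exists_lt_of_sum_lt (R : realFieldType) (I : finType) (F : I -> R) (B : R) :
  \sum_i F i < #|I|%:R * B -> exists i, F i < B.
Proof.
move=> lt_sum; apply/existsP; apply: contraLR lt_sum => /existsPn geF.
rewrite -leNgt mulr_natl -sumr_const; apply: ler_sum => i _.
by rewrite leNgt geF.
Qed.

Lemma sum_flip (R : realFieldType) (n : nat) (a : R) (c x : n.-tuple bool) :
  \sum_(i < n) a ^+ hamming n c (flip n x i) =
    (hamming n c x)%:R * a ^+ (hamming n c x).-1 +
    (n%:R - (hamming n c x)%:R) * a ^+ (hamming n c x).+1.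
Proof.
rewrite (bigID (fun i => tnth c i != tnth x i)) /=; congr (_ + _).
  under eq_bigr => i ci do rewrite hamming_flip ci.
  by rewrite sumr_const mulr_natl; congr (_ *+ _); apply: eq_card => i; rewrite !inE.
under eq_bigr => i ci do rewrite hamming_flip (negbTE ci).
rewrite sumr_const -[LHS]mulr_natl; congr (_ * _).
have /(congr1 (fun m => m%:R : R)) := cardsC [set i | tnth c i != tnth x i]%SET.
rewrite card_ord natrD => <-.
rewrite addrC addKr; congr (_%:R).
by apply: eq_card => i; rewrite !inE.
Qed.

Lemma bernoulli (R : realFieldType) (y : R) (m : nat) :
  0 <= y -> 1 + m%:R * y <= (1 + y) ^+ m.
Proof.
move=> y0; elim: m => [|m IH]; first by rewrite mul0r addr0 expr0.
have m0 : 0 <= m%:R :> R by [].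
rewrite exprS -natr1; apply: le_trans (ler_wpM2l _ IH); nra.
Qed.

(** With [m] the distance from [c] to [x] and [y = (a^-2 - 1) / n], the sum equals
    [n a^(m+1) (1 + m y)]. Bernoulli bounds [1 + m y] by [(1 + y)^m], and [a (1 + y)] is the
    quantity assumed to be at most [a']. *)
Lemma sum_flip_le (R : realFieldType) (n : nat) (a a' : R) (c x : n.-tuple bool) :
  (0 < n)%N -> 0 < a -> a <= 1 -> a + (a^-1 - a) / n%:R <= a' ->
  \sum_(i < n) a ^+ hamming n c (flip n x i) <= n%:R * (a * a' ^+ hamming n c x).
Proof.
move=> n0 a0 a1 aa'; have nR : 0 < n%:R :> R by rewrite ltr0n.
rewrite sum_flip; move: (hamming n c x) => m.
have y0 : 0 <= (a^-2 - 1) / n%:R.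
  apply: divr_ge0; last exact: ltW.
  by rewrite subr_ge0 invf_ge1 ?exprn_gt0// exprn_ile1// ltW.
have le1 : a * (1 + (a^-2 - 1) / n%:R) <= a'.
  apply: le_trans aa'; rewrite le_eqVlt; apply/orP; left; apply/eqP; field; lra.
have le2 : a ^+ m * (1 + m%:R * ((a^-2 - 1) / n%:R)) <= a' ^+ m.
  apply: (@le_trans _ _ ((a * (1 + (a^-2 - 1) / n%:R)) ^+ m)).
    by rewrite exprMn; apply: ler_wpM2l; [rewrite exprn_ge0 ?ltW | exact: bernoulli].
  have z0 := mulr_ge0 (ltW a0) (addr_ge0 ler01 y0).
  by apply: lerXn2r => //; rewrite nnegrE //; exact: le_trans le1.
have -> : m%:R * a ^+ m.-1 + (n%:R - m%:R) * a ^+ m.+1 =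
    n%:R * (a * (a ^+ m * (1 + m%:R * ((a^-2 - 1) / n%:R)))).
  (* At [m = 0] the truncated predecessor is harmless because its coefficient vanishes. *)
  case: m {le2} => [|m]; first by rewrite /= expr0 expr1; ring.
  by rewrite /= !exprS; field; lra.
by rewrite ler_pM2l// ler_pM2l.
Qed.

(** The sum factors over the coordinates: each contributes [1] for agreement with [c] and [a] for
    disagreement. *)
Lemma sum_hamming (R : realFieldType) (n : nat) (a : R) (c : n.-tuple bool) :
  \sum_(x : n.-tuple bool) a ^+ hamming n c x = (1 + a) ^+ n.
Proof.
transitivity (\sum_(f : {ffun 'I_n -> bool}) \prod_(i < n) a ^+ (tnth c i != f i)).
  rewrite (reindex (fun f : {ffun 'I_n -> bool} => [tuple f i | i < n])) /=.
    apply: eq_bigr => f _; rewrite /hamming -sum1_card -prodrXr big_mkcond /=.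
    apply: eq_bigr => i _; rewrite inE tnth_mktuple.
    by case: (_ != _).
  exists (fun x : n.-tuple bool => [ffun i => tnth x i]) => x _.
    by apply/ffunP => i; rewrite ffunE tnth_mktuple.
  by apply: eq_from_tnth => i; rewrite tnth_mktuple ffunE.
rewrite -(bigA_distr_bigA (fun i b => a ^+ (tnth c i != b))) /=.
rewrite -[in RHS](card_ord n) -prodr_const; apply: eq_bigr => i _.
rewrite big_bool /=; case: (tnth c i) => /=; rewrite ?expr0 ?expr1 //.
by rewrite addrC.
Qed.

(** * The greedy robber and his invariant *)

Definition potential (R : realFieldType) (n k : nat) (a : R)
    (c : cops (n.-tuple bool) k) (x : n.-tuple bool) : R :=
  \sum_(j < k) a ^+ hamming n (c j) x.

Definition greedy_start (R : realFieldType) (n k : nat) (a : nat -> R)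
    (c : cops (n.-tuple bool) k) : n.-tuple bool :=
  odflt [tuple false | _ < n] [pick x | potential R n k (a 0%N) c x < a 0%N].

(** [size h] counts the completed rounds, so [(size h).+1] indexes the weight that must hold once
    the present move is made. *)
Definition greedy_move (R : realFieldType) (n k : nat) (a : nat -> R)
    (h : seq (position (n.-tuple bool) k)) (p : position (n.-tuple bool) k)
    (c : cops (n.-tuple bool) k) : n.-tuple bool :=
  let a' := a (size h).+1 in
  if [pick i | potential R n k a' c (flip n p.2 i) < a'] is Some i
  then flip n p.2 i else p.2.

Lemma greedy_legal (R : realFieldType) (n k : nat) (a : nat -> R)
    (h : seq (position (n.-tuple bool) k)) (p : position (n.-tuple bool) k)
    (c : cops (n.-tuple bool) k) :
  step (@hypercube n) p.2 (greedy_move R n k a h p c).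
Proof.
rewrite /greedy_move; case: pickP => [i _|_]; first exact: step_flip.
by rewrite /step eqxx.
Qed.

Definition greedy (R : realFieldType) (n k : nat) (a : nat -> R) :
    robber_strategy (@hypercube n) k :=
  RobberStrategy (greedy_start R n k a) (greedy_legal R n k a).

Lemma size_play (T : finType) (adj : rel T) (k : nat) (s : cop_strategy adj k)
    (r : robber_strategy adj k) (t : nat) : size (play s r t).1 = t.
Proof. by elim: t => //= t; case: (play s r t) => h p /= ->. Qed.

Lemma potential_captured (R : realFieldType) (n k : nat) (a : R)
    (p : position (n.-tuple bool) k) :
  0 < a -> captured p -> 1 <= potential R n k a p.1 p.2.
Proof.
move=> a0 /existsP[i /eqP pi]; rewrite /potential (bigD1 i) //= pi hammingxx expr0.
by rewrite lerDl sumr_ge0// => j _; rewrite exprn_ge0// ltW.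
Qed.

Lemma potential_cop_move (R : realFieldType) (n k : nat) (a : R)
    (c c' : cops (n.-tuple bool) k) (x : n.-tuple bool) :
  0 < a -> a <= 1 -> (forall i, step (@hypercube n) (c i) (c' i)) ->
  potential R n k a c x < a -> potential R n k a c' x < 1.
Proof.
move=> a0 a1 cc' lt_a; rewrite -(ltr_pM2l a0) mulr1; apply: le_lt_trans lt_a.
rewrite /potential mulr_sumr; apply: ler_sum => i _; rewrite -exprS.
apply: ler_wiXn2l; [exact: ltW | exact: a1 |].
apply: leq_trans (hamming_triangle n (c i) (c' i) x) _.
by rewrite -add1n leq_add2r; apply: hamming_step.
Qed.

(** [a'] is the old weight and [a] the new one. By [sum_flip_le] the mean over all flips is at most
    [a] times the old potential, hence below [a], and some flip does no worse than the mean. *)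
Lemma potential_robber_move (R : realFieldType) (n k : nat) (a a' : R)
    (c : cops (n.-tuple bool) k) (x : n.-tuple bool) :
  (0 < n)%N -> 0 < a -> a <= 1 -> a + (a^-1 - a) / n%:R <= a' ->
  potential R n k a' c x < 1 -> exists i, potential R n k a c (flip n x i) < a.
Proof.
move=> n0 a0 a1 aa' lt1; apply: exists_lt_of_sum_lt; rewrite card_ord.
rewrite /potential exchange_big /=.
apply: (@le_lt_trans _ _ (n%:R * (a * potential R n k a' c x))).
  rewrite /potential !mulr_sumr; apply: ler_sum => j _; exact: sum_flip_le.
by rewrite ltr_pM2l ?ltr0n// -[ltRHS]mulr1 ltr_pM2l.
Qed.

(** The left-hand side of the hypothesis is the mean of the potential over all [2^n] vertices. *)
Lemma potential_start (R : realFieldType) (n k : nat) (a : R)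
    (c : cops (n.-tuple bool) k) :
  k%:R * ((1 + a) / 2) ^+ n < a -> exists x, potential R n k a c x < a.
Proof.
move=> lt_a; apply: exists_lt_of_sum_lt; rewrite /potential exchange_big /=.
under eq_bigr do rewrite sum_hamming.
rewrite sumr_const !card_ord card_tuple card_bool natrX.
rewrite expr_div_n mulrA ltr_pdivrMr ?exprn_gt0// [ltRHS]mulrC in lt_a.
by rewrite -[ltLHS]mulr_natl.
Qed.

Lemma greedy_evades (R : realFieldType) (n k N : nat) (a : nat -> R)
    (s : cop_strategy (@hypercube n) k) :
  (0 < n)%N -> (forall t, 0 < a t) -> (forall t, (t <= N)%N -> a t <= 1) ->
  (forall t, (t < N)%N ->
     a t.+1 + ((a t.+1)^-1 - a t.+1) / n%:R <= a t) ->
  k%:R * ((1 + a 0%N) / 2) ^+ n < a 0%N ->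
  evades s (greedy R n k a) N.
Proof.
move=> n0 a0 a1 step_a start_a; set r := greedy R n k a.
(* Conditional on the invariant, so that it serves both the induction step of [inv] and the midround
   half of the conclusion. *)
have mid t : (t < N)%N ->
    potential R n k (a t) (position_after s r t).1 (position_after s r t).2 < a t ->
    potential R n k (a t) (midround_position s r t).1 (midround_position s r t).2 < 1.
  move=> tN; apply: potential_cop_move => //; first exact/a1/ltnW.
  move=> i; rewrite /midround_position /position_after /=.
  case: (play s r t) => h p /=; exact: cop_legal.
have inv t : (t <= N)%N ->
    potential R n k (a t) (position_after s r t).1 (position_after s r t).2 < a t.
  elim: t => [_|t IH tN].
    rewrite /position_after /= /greedy_start; case: pickP => //= none.
    by have [x] := potential_start R n k _ (cop_start s) start_a; rewrite none.
  have := mid t tN (IH (ltnW tN)).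
  have sz := size_play _ _ _ s r t.
  rewrite /midround_position /position_after /=.
  case: (play s r t) sz => h p /= sz.
  move=> /(potential_robber_move _ _ _ _ _ _ _ n0 (a0 _) (a1 _ tN) (step_a _ tN)) [i lt_i].
  rewrite /greedy_move sz; case: pickP => //= none.
  by rewrite none in lt_i.
split=> t tN; apply/negP => /(potential_captured R n k (a t) _ (a0 t)); apply/negP.
  by rewrite -ltNge; apply: lt_le_trans (inv t tN) (a1 t tN).
by rewrite -ltNge; apply: mid => //; apply: inv; exact: ltnW.
Qed.

(** * Choice of the weights *)

Lemma evades_of_rate (R : realFieldType) (n k N : nat) (delta q : R)
    (s : cop_strategy (@hypercube n) k) :
  (0 < n)%N -> 0 < delta -> delta <= 4^-1 ->
  q = 1 - (2 + 2 * delta) / n%:R -> 0 < q ->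
  k%:R * (1 - delta * q ^+ N / 2) ^+ n < 2^-1 ->
  exists r, evades s r N.
Proof.
move=> n0 d0 d1 qE q0 lt_k.
have nR : 0 < n%:R :> R by rewrite ltr0n.
have q1 : q <= 1 by rewrite qE lerBlDr lerDl divr_ge0 //; lra.
have b0 m : 0 < delta * q ^+ m by rewrite mulr_gt0 ?exprn_gt0.
have b1 m : delta * q ^+ m <= delta by rewrite ger_pMr // exprn_ile1 // ltW.
exists (greedy R n k (fun t => 1 - delta * q ^+ (N - t))).
apply: greedy_evades => //.
- by move=> t; have := b1 (N - t)%N; lra.
- by move=> t _; have := b0 (N - t)%N; lra.
(* With [b] the deficit [1 - a] at time [t.+1], the deficit at time [t] is [q * b]. *)
- move=> t tN; rewrite -(subnSK tN) exprS.
  have := b0 (N - t.+1)%N; have := b1 (N - t.+1)%N.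
  rewrite mulrCA; move: (delta * _) => b ble bgt.
  have -> : q * b = b - b * (2 + 2 * delta) / n%:R by rewrite qE; field; lra.
  (* Multiplying by [1 - b] and cancelling [b] turns this into [b (1 + 2 delta) <= 2 delta], which
     holds since [b <= delta <= 1/4]. *)
  have : (1 - b)^-1 - (1 - b) <= b * (2 + 2 * delta).
    rewrite -(ler_pM2l (x := 1 - b)); last lra.
    rewrite mulrBr divff; last lra.
    nra.
  rewrite -(ler_pM2r (x := n%:R^-1)) ?invr_gt0 //; lra.
- rewrite subn0; apply: lt_le_trans (_ : 2^-1 <= _); last by have := b1 N; lra.
  have -> : (1 + (1 - delta * q ^+ N)) / 2 = 1 - delta * q ^+ N / 2 by field.
  exact: lt_k.
Qed.

(** * Exponential estimates *)

Lemma expR_neg_le (R : realType) (x z : R) :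
  0 <= z -> 1 <= (1 - x) * (1 + z) -> expR (- z) <= 1 - x.
Proof.
move=> z0 h; have x1 : 0 < 1 - x by nra.
rewrite expRN invf_ple ?posrE ?expR_gt0//.
apply: le_trans (expR_ge1Dx z); rewrite -(ler_pM2l x1) divff //; lra.
Qed.

Lemma expr_1B_le_expR (R : realType) (n : nat) (y : R) :
  y <= 1 -> (1 - y) ^+ n <= expR (- (y * n%:R)).
Proof.
move=> y1; rewrite -mulNr expRM_natr; apply: lerXn2r; rewrite ?nnegrE ?expR_ge0//.
  lra.
exact: expR_ge1Dx.
Qed.

(* Here [u] is [sqrt (ln n)], so that [eps = 1 / u] and [delta = eps / 4]. *)
Lemma potential_decay (R : realType) (d u q : R) (n k N : nat) :
  0 < d -> 128 * 384 * (d + 3) <= u -> n%:R = expR (u ^+ 2) ->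
  k%:R <= expR (d * u ^+ 2) + 1 ->
  N%:R <= (1 - u^-1) * (2^-1 * n%:R * u ^+ 2) + 1 ->
  q = 1 - (2 + 2 * (u^-1 / 4)) / n%:R ->
  0 < q /\ k%:R * (1 - u^-1 / 4 * q ^+ N / 2) ^+ n < 2^-1.
Proof.
move=> d0 ud nE kle Nle qE.
have u16 : 256 <= u by lra.
have u0 : 0 < u by lra.
have n16 : 16 * u <= n%:R by rewrite nE; have := expR_ge1Dx (u ^+ 2); nra.
have n0 : 0 < n%:R :> R by nra.
set e := u^-1 in Nle qE *.
have ue : u * e = 1 by rewrite divff // gt_eqF.
have e0 : 0 < e by rewrite invr_gt0.
have e1 : e <= 1 by nra.
(* The exponent uses [2 + e] where [q] has [2 + 2 delta = 2 + e / 2]; the spare [e / 2] absorbs the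
   second-order term once [n e >= 16]. *)
have qge : expR (- ((2 + e) / n%:R)) <= q.
  rewrite qE; apply: expR_neg_le; first by rewrite divr_ge0 //; lra.
  have -> : (1 - (2 + 2 * (e / 4)) / n%:R) * (1 + (2 + e) / n%:R) =
     1 + (n%:R * e / 2 - (2 + e / 2) * (2 + e)) / n%:R ^+ 2 by field; lra.
  rewrite lerDl divr_ge0 ?exprn_ge0 ?ltW //.
  have : 16 <= n%:R * e by have := ler_wpM2r (ltW e0) n16; rewrite -mulrA ue; lra.
  nra.
have q0 : 0 < q by apply: lt_le_trans qge; exact: expR_gt0.
split=> //.
(* Since [u e = 1], [(2 + e) (1 - e) u^2 / 2 = u^2 - u / 2 - 1 / 2], and [n = expR (u^2)] cancels
   the [u^2]. What survives is [n^(eps / 2) = expR (u / 2)]; the [- 1] leaves room for rounding [N]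
   up. *)
have qN : expR (u / 2 - 1) <= n%:R * q ^+ N.
  have : expR (- ((2 + e) / n%:R) * N%:R) <= q ^+ N.
    by rewrite expRM_natr; apply: lerXn2r; rewrite ?nnegrE ?expR_ge0 // ltW.
  rewrite -(ler_pM2l n0); apply: le_trans; rewrite {1}nE -expRD ler_expR.
  have z0 : 0 <= (2 + e) / n%:R by rewrite divr_ge0 //; lra.
  have := ler_wpM2l z0 Nle.
  have -> : (2 + e) / n%:R * ((1 - e) * (2^-1 * n%:R * u ^+ 2) + 1) =
     u ^+ 2 - u * (u * e) / 2 - (u * e) ^+ 2 / 2 + (2 + e) / n%:R by field; lra.
  rewrite ue.
  have : (2 + e) / n%:R <= 1 by rewrite ler_pdivrMr //; lra.
  lra.
have y1 : e / 4 * q ^+ N / 2 <= 1.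
  have : q ^+ N <= 1.
    by rewrite exprn_ile1 ?ltW // qE ltrBlDr ltrDl divr_gt0 //; lra.
  have : 0 < q ^+ N by rewrite exprn_gt0.
  move: (q ^+ N) => w; nra.
have yn : d * u ^+ 2 + 3 <= e / 4 * q ^+ N / 2 * n%:R.
  have -> : e / 4 * q ^+ N / 2 * n%:R = e * (n%:R * q ^+ N) / 8 by field.
  suff : 8 * (d * u ^+ 2 + 3) * u <= n%:R * q ^+ N.
    by move=> /(ler_wpM2l (ltW e0)); rewrite mulrCA [e * u]mulrC ue; lra.
  apply: le_trans qN.
  have : expR (u / 4) <= expR (u / 2 - 1) by rewrite ler_expR; lra.
  apply: le_trans.
  have u40 : 0 <= u / 4 by lra.
  (* The quartic term of the exponential series at [u / 4] is [u^4 / 6144]. As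
     [128 * 384 = 8 * 6144], the threshold on [u] makes it at least [8 (d + 3) u^3]. *)
  have := expR_ge1Dxn 3 u40.
  have -> : (3.+1)`!%:R = 24 :> R by [].
  have -> : (u / 4) ^+ 4 / 24 = u ^+ 3 * u / 6144 by field.
  have u3 : 0 <= u ^+ 3 by rewrite exprn_ge0 // ltW.
  have := ler_wpM2l u3 ud.
  have : 1 <= u ^+ 2 by nra.
  move: (ltW u0) => u0' u21.
  have : u <= u ^+ 3 by rewrite exprS ler_peMr.
  have -> : 8 * (d * u ^+ 2 + 3) * u = 8 * (d * u ^+ 3) + 24 * u by ring.
  lra.
have k0 : 0 <= k%:R :> R by [].
(* The [+ 1] from rounding [n^d] at most doubles the first factor, and the [3] in the exponent
   leaves [2 * expR (- 3)], below [1 / 2] because [expR 3 > 4]. *)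
apply: (@le_lt_trans _ _ ((expR (d * u ^+ 2) + 1) * expR (- (d * u ^+ 2 + 3)))).
  apply: ler_pM => //; first by rewrite exprn_ge0 //; lra.
  apply: le_trans (expr_1B_le_expR _ _ _ y1) _.
  by rewrite ler_expR lerN2.
have dl : 1 <= expR (d * u ^+ 2).
  by rewrite -expR0 ler_expR mulr_ge0 ?exprn_ge0 ?ltW.
apply: (@le_lt_trans _ _ (2 * expR (- 3))).
  have -> : 2 * expR (- 3) = 2 * expR (d * u ^+ 2) * expR (- (d * u ^+ 2 + 3)).
    by rewrite -mulrA -expRD; congr (_ * expR _); ring.
  by rewrite ler_pM2r ?expR_gt0 //; lra.
have e3 : 4 < expR (3 : R).
  by apply: le_lt_trans (expR_gt1Dx _); [lra | rewrite pnatr_eq0].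
rewrite expRN ltr_pdivrMr ?expR_gt0 //; lra.
Qed.

(** * Large [n] and the choice of [N] *)

Local Open Scope classical_set_scope.

Lemma near_sqrt_ln_ge (R : realType) (M : R) :
  \forall n \near \oo, M <= Num.sqrt (ln (n%:R : R)).
Proof.
near=> n.
have le_n : expR (M ^+ 2) <= n%:R by near: n; exact: nbhs_infty_ger.
(* [M] may be negative, hence the detour through [|M| = sqrt (M^2)]. *)
apply: le_trans (ler_norm M) _; rewrite -sqrtr_sqr ler_wsqrtr //.
by rewrite -[leLHS]expRK ler_ln // posrE ?expR_gt0 // (lt_le_trans _ le_n) ?expR_gt0.
Unshelve. all: by end_near. Qed.

(** The condition [|k - n^d| < 1] covers rounding the real number [n^d] either way. *)
Theorem theorem3p3 (R : realType) (d : R) (hd : 0 < d) :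
  exists eps : nat -> R,
    eps n @[n --> \oo] --> (0 : R) /\
    \forall n \near \oo,
      forall k : nat, `|k%:R - n%:R `^ d| < 1 ->
      forall s : cop_strategy (@hypercube n) k,
      exists r : robber_strategy (@hypercube n) k,
      exists N : nat,
        (1 - eps n) * (2^-1 * n%:R * ln (n%:R)) <= N%:R /\
        evades s r N.
Proof.
exists (fun n => (Num.sqrt (ln (n%:R : R)))^-1); split.
  apply/cvgrPdist_lt => e e0; near=> n.
  have le_n : e^-1 + 1 <= Num.sqrt (ln (n%:R : R)).
    by near: n; exact: near_sqrt_ln_ge.
  have ie0 : 0 < e^-1 by rewrite invr_gt0.
  rewrite sub0r normrN ger0_norm ?invr_ge0 ?sqrtr_ge0 // invf_plt ?posrE //; lra.
near=> n => k hk s.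
have le_u : 128 * 384 * (d + 3) <= Num.sqrt (ln (n%:R : R)).
  by near: n; exact: near_sqrt_ln_ge.
have n_gt0 : (0 < n)%N by near: n; exact: nbhs_infty_gt.
move: le_u; set u := Num.sqrt _ => le_u.
have u0 : 0 < u by lra.
have lnE : ln (n%:R : R) = u ^+ 2.
  by rewrite sqr_sqrtr // ln_ge0 // ler1n.
have nE : n%:R = expR (u ^+ 2) by rewrite -lnE lnK // posrE ltr0n.
have kle : k%:R <= expR (d * u ^+ 2) + 1.
  move: hk; rewrite /powR pnatr_eq0 gtn_eqF // lnE ltr_norml => /andP[_]; lra.
have u1 : u^-1 <= 1 by rewrite invf_ple ?posrE // invr1; lra.
have ui0 : 0 < u^-1 by rewrite invr_gt0.
rewrite lnE; set T := (1 - u^-1) * _.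
have T0 : 0 <= T by rewrite !mulr_ge0 ?exprn_ge0 //; lra.
have /andP[T1 T2] := truncn_itv T0.
(* [N] is [(trunc T).+1]: it must reach [T], and [potential_decay] tolerates up to [T + 1]. *)
have Nle : (Num.trunc T).+1%:R <= T + 1 by rewrite -natr1; lra.
have [q0 lt_k] := potential_decay _ _ _ _ _ _ _ hd le_u nE kle Nle erefl.
have d0 : 0 < u^-1 / 4 by rewrite divr_gt0.
have d1 : u^-1 / 4 <= 4^-1 by lra.
have [r ev] := evades_of_rate _ _ _ _ _ _ s n_gt0 d0 d1 erefl q0 lt_k.
by exists r, (Num.trunc T).+1; split=> //; exact: ltW.
Unshelve. all: by end_near. Qed.
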